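(* Let $m,m'>0$, and let $S_j=mj$ and $d_j=1$ for all integers $j\ge0$. Let $F:\mathbb{R}\to\mathbb{R}$ be the function built from $(S_j)$ and $(d_j)$ as described in the context. Let $\theta_0=0$ and let $(\theta_j)_{j\ge1}$ be generated by the two-step negative curvature method with step sizes $m,m'$ (described in the context) applied to $F$. Then $\lim_j F(\theta_j)=\infty$ and $\inf_j|\dot F(\theta_j)|=1$.
   Context: $\dot F,\ddot F$ denote the first and second derivatives of $F$. Two-step negative curvature method (one-dimensional case), with initial point $\theta_0$ and step sizes $m,m'>0$: for $k=0,1,2,\dots$, if $\ddot F(\theta_k)\ge0$ set $s_k'=0$, otherwise let $s_k'$ be any direction that is both a descent direction and a direction of negative curvature at $\theta_k$; set $s_k=-\dot F(\theta_k)$ (which is $0$ if $\dot F(\theta_k)=0$); if $s_k=s_k'=0$, stop and return $\theta_k$; otherwise $\theta_{k+1}=\theta_k+m s_k+m' s_k'$. For $m>0$ and $d,\delta\in(0,1]$ let $f(\cdot\,;m,d,\delta):[0,m]\to\mathbb{R}$ be given by $$f(\theta;m,d,\delta)=\begin{cases} -d\theta & \theta\in(0,\frac{2-d}{16}m)\\ \frac{8}{m}(\theta-\frac m8)^2-m\frac{-d^2+4d}{32} & \theta\in[\frac{2-d}{16}m,\frac{3}{16}m)\\ -\frac{5m}{16}\exp\left(\frac{5/16}{\theta/m-1/2}+1\right)+m\frac{11+d^2-4d}{32} & \theta\in(\frac{3}{16}m,\frac12 m)\\ m\frac{11+d^2-4d}{32} & \theta=\frac12 m\\ \frac{5m}{16}\exp\left(\frac{-5/16}{\theta/m-1/2}+1\right)+m\frac{11+d^2-4d}{32}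 & \theta\in(\frac12 m,\frac{13}{16}m)\\ -\frac{8}{m}(\theta-\frac{7m}{8})^2+m\frac{22+d^2-4d}{32} & \theta\in[\frac{13}{16}m,\frac{\delta+14}{16}m)\\ -\delta\theta+m\frac{22+d^2+\delta^2-4d+28\delta}{32} & \theta\in[\frac{\delta+14}{16}m,m] \end{cases}$$ and extended to $\theta=0$ and $\theta=\frac{3}{16}m$ by continuity. Given a strictly increasing real sequence $(S_j)_{j\ge0}$ and a sequence $(d_j)_{j\ge 0}$ in $(0,1]$, the function $F$ is defined (recursively in $j$) on $(-\infty,\sup_j S_j)$ by $F(\theta)=-d_0(\theta-S_0)$ for $\theta\le S_0$; $F(\theta)=f(\theta-S_0;S_1-S_0,d_0,d_1)$ for $\theta\in(S_0,S_1]$; and $F(\theta)=f(\theta-S_j;S_{j+1}-S_j,d_j,d_{j+1})+F(S_j)$ for $\theta\in(S_j,S_{j+1}]$, $j=1,2,\dots$. It is defined on all of $\mathbb{R}$ when $\sup_j S_j=\infty$. *)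

(* Defs.v *)
From HB Require Import structures.
From mathcomp Require Import all_boot all_order all_algebra.
From mathcomp Require Import all_classical all_reals all_analysis.

Set Implicit Arguments.
Unset Strict Implicit.
Unset Printing Implicit Defensive.

Import Order.TTheory GRing.Theory Num.Theory numFieldNormedType.Exports.

Local Open Scope classical_set_scope.
Local Open Scope ring_scope.

(* For 0 < m and d, delta in (0, 1] the break points below are increasing, so
   the cascade of tests selects the intended interval on ]0, m] minus
   {3 m / 16}.  The values at 0 and 3 m / 16, and outside [0, m], are not
   meaningful: the former two are overridden in [piece]. *)
Definition piece_raw (R : realType) (m d delta theta : R) : R :=
  if theta < (2 - d) / 16 * m then - d * theta
  else if theta < 3 / 16 * m then
    8 / m * (theta - m / 8) ^+ 2 - m * ((- d ^+ 2 + 4 * d) / 32)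
  else if theta < m / 2 then
    - (5 * m / 16) * expR ((5 / 16) / (theta / m - 1 / 2) + 1)
    + m * ((11 + d ^+ 2 - 4 * d) / 32)
  else if theta == m / 2 then m * ((11 + d ^+ 2 - 4 * d) / 32)
  else if theta < 13 / 16 * m then
    5 * m / 16 * expR ((- (5 / 16)) / (theta / m - 1 / 2) + 1)
    + m * ((11 + d ^+ 2 - 4 * d) / 32)
  else if theta < (delta + 14) / 16 * m then
    - (8 / m) * (theta - 7 * m / 8) ^+ 2 + m * ((22 + d ^+ 2 - 4 * d) / 32)
  else
    - delta * theta
    + m * ((22 + d ^+ 2 + delta ^+ 2 - 4 * d + 28 * delta) / 32).

(* The limit is taken inside [0, m], along the punctured neighbourhood. *)
Definition piece (R : realType) (m d delta theta : R) : R :=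
  if (theta == 0) || (theta == 3 / 16 * m) then
    lim (piece_raw m d delta x @[x --> within `[0, m] theta^'])
  else piece_raw m d delta theta.

(* [node_value S d j] is the value at [S j] of the function [chain S d]. *)
Fixpoint node_value (R : realType) (S d : nat -> R) (j : nat) : R :=
  if j is i.+1 then
    piece (S i.+1 - S i) (d i) (d i.+1) (S i.+1 - S i) + node_value S d i
  else 0.

(* Only meaningful below sup_j S_j: [xget] returns the unique j such that
   S_j < theta <= S_(j+1) when there is one. *)
Definition chain (R : realType) (S d : nat -> R) (theta : R) : R :=
  if theta <= S 0%N then - d 0%N * (theta - S 0%N)
  else
    let j := xget 0%N [set j | S j < theta <= S j.+1] in
    piece (S j.+1 - S j) (d j) (d j.+1) (theta - S j) + node_value S d j.

Lemma chain_node (R : realType) (S d : nat -> R) (j : nat) (theta : R) :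
  (forall i, S i < S i.+1) -> S j < theta <= S j.+1 ->
  chain S d theta =
  piece (S j.+1 - S j) (d j) (d j.+1) (theta - S j) + node_value S d j.
Proof.
move=> /increasing_seqP S_mono /andP[jt tj].
rewrite /chain ifF; last first.
  by apply/negbTE; rewrite -ltNge (le_lt_trans _ jt)// S_mono.
suff -> : xget 0%N [set i | S i < theta <= S i.+1] = j by [].
apply: xget_unique => [|i /= /andP[it ti]]; first by rewrite /= jt tj.
have ij : (i <= j)%N.
  by have := leW_mono S_mono i j.+1; rewrite (lt_le_trans it tj) => /esym.
have ji : (j <= i)%N.
  by have := leW_mono S_mono j i.+1; rewrite (lt_le_trans jt ti) => /esym.
by apply/eqP; rewrite eqn_leq ij.
Qed.

(* The three clauses of the recursive definition. *)
Lemma chain_init (R : realType) (S d : nat -> R) (theta : R) :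
  theta <= S 0%N -> chain S d theta = - d 0%N * (theta - S 0%N).
Proof. by rewrite /chain => ->. Qed.

Lemma chain_first (R : realType) (S d : nat -> R) (theta : R) :
  (forall i, S i < S i.+1) -> S 0%N < theta <= S 1%N ->
  chain S d theta = piece (S 1%N - S 0%N) (d 0%N) (d 1%N) (theta - S 0%N).
Proof. by move=> Si t; rewrite (chain_node _ Si t) addr0. Qed.

Lemma chain_next (R : realType) (S d : nat -> R) (j : nat) (theta : R) :
  (forall i, S i < S i.+1) -> (1 <= j)%N -> S j < theta <= S j.+1 ->
  chain S d theta =
  piece (S j.+1 - S j) (d j) (d j.+1) (theta - S j) + chain S d (S j).
Proof.
case: j => // j Si _ t; rewrite (chain_node _ Si t); congr (_ + _).
by rewrite (@chain_node _ S d j)// Si lexx.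
Qed.

(* s points to smaller values of F for all small enough positive steps; this is
   implied by F'(theta) s < 0 and, unlike the latter, can also hold at a
   critical point of negative curvature. *)
Definition descent_direction (R : realType) (F : R -> R) (theta s : R) : Prop :=
  \forall t \near 0^'+, F (theta + t * s) < F theta.

Definition negative_curvature_direction (R : realType) (F : R -> R)
    (theta s : R) : Prop :=
  s * F^`(2)%classic theta * s < 0.

Definition curvature_step (R : realType) (F : R -> R) (theta s' : R) : Prop :=
  if 0 <= F^`(2)%classic theta then s' = 0
  else descent_direction F theta s' /\ negative_curvature_direction F theta s'.

(* One iteration is a relation, since s' is not prescribed by the method;
   [None] means that the method stops at theta.  The derivatives F^`() and
   F^`(2) are total operators, with value 0 where the difference quotient has
   no limit. *)
Definition two_step (R : realType) (F : R -> R) (m m' theta : R)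
    (next : option R) : Prop :=
  let s := - F^`()%classic theta in
  exists2 s', curvature_step F theta s' &
    next = if (s == 0) && (s' == 0) then None
           else Some (theta + m * s + m' * s').

(* [run k] is [None] from the moment the method has stopped. *)
Definition two_step_run (R : realType) (F : R -> R) (m m' theta0 : R)
    (run : nat -> option R) : Prop :=
  run 0%N = Some theta0 /\
  forall k, if run k is Some theta then two_step F m m' theta (run k.+1)
            else run k.+1 = None.

(* Main.v *)
Require Import Defs.
From HB Require Import structures.
From mathcomp Require Import all_boot all_order all_algebra.
From mathcomp Require Import all_classical all_reals all_analysis.
From mathcomp Require Import ring lra.

Set Implicit Arguments.
Unset Strict Implicit.
Unset Printing Implicit Defensive.

Import Order.TTheory GRing.Theory Num.Theory numFieldNormedType.Exports.

Local Open Scope classical_set_scope.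
Local Open Scope ring_scope.

(** The method only ever sees [F] near the nodes [m * j], and there [F] is
    indistinguishable from a straight line.  Each piece begins with slope
    [- d] and ends with slope [- delta], and the slope [- d j.+1] with which
    the [j]-th piece ends is the one with which the next piece begins; so
    around [S j] the function [chain S d] is affine of slope [- d j]
    ([chain_near_node]).  When all [d j] are 1, this makes the first derivative
    -1 and the second derivative 0 at every node: the negative curvature step
    vanishes, and the gradient step of size [m] leads from [m * j] exactly to
    the next node [m * j.+1].  Hence the iterates are the nodes
    ([two_step_affine] and induction).  The derivative along the run is
    constantly -1, whereas [F] gains [m / 2] over each piece
    ([node_value_uniform]), the climb in the middle of the piece being invisible
    to the method, so that [F] grows linearly along the run. *)

(** It is the bound [-1 < d] that keeps this initial stretch away from
    [3 / 16 * m], where [piece] is a limit. *)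
Lemma piece_start (R : realType) (m d delta t : R) :
  0 < m -> -1 < d -> 0 < t < (2 - d) / 16 * m ->
  piece m d delta t = - d * t.
Proof.
move=> m0 d0 /andP[t0 tm]; have dm : 0 < (d + 1) * m by apply: mulr_gt0; lra.
rewrite /piece ifF ?/piece_raw ?tm//.
by apply/negbTE/norP; split; apply/eqP; lra.
Qed.

Lemma piece_end (R : realType) (m d delta t : R) :
  0 < m -> 0 <= d -> -1 < delta -> (delta + 14) / 16 * m <= t ->
  piece m d delta t =
  - delta * t + m * ((22 + d ^+ 2 + delta ^+ 2 - 4 * d + 28 * delta) / 32).
Proof.
move=> m0 d0 delta0 tm.
have dm : 0 <= d * m by apply: mulr_ge0; lra.
have deltam : 0 < (delta + 1) * m by apply: mulr_gt0; lra.
rewrite /piece ifF; last by apply/negbTE/norP; split; apply/eqP; lra.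
rewrite /piece_raw !ifF//; apply/negbTE; rewrite -?leNgt; lra.
Qed.

(** The left half of the neighbourhood of [S j] lies in the final affine stretch
    of the previous piece (or in the initial half-line when [j] is 0), the
    right half in the initial affine stretch of the next one. *)
Lemma chain_near_node (R : realType) (S d : nat -> R) (j : nat) :
  (forall i, S i < S i.+1) -> (forall i, 0 < d i <= 1) ->
  \forall x \near S j, chain S d x = node_value S d j - d j * (x - S j).
Proof.
move=> Si di.
have d0 i : 0 < d i by case/andP: (di i).
have d1 i : d i <= 1 by case/andP: (di i).
have right x : S j < x -> x < S j + (2 - d j) / 16 * (S j.+1 - S j) ->
    chain S d x = node_value S d j - d j * (x - S j).
  move=> jx xj.
  have m0 : 0 < S j.+1 - S j by rewrite subr_gt0.
  have dm : 0 < d j * (S j.+1 - S j) by exact: mulr_gt0.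
  rewrite (@chain_node _ S d j)//; last by lra.
  rewrite piece_start//; [ring|by have := d0 j; lra|].
  by apply/andP; split; lra.
have right_lt : S j < S j + (2 - d j) / 16 * (S j.+1 - S j).
  by rewrite ltrDl mulr_gt0 ?subr_gt0//; have := d1 j; lra.
have left : exists2 a, a < S j & forall x, a < x -> x <= S j ->
    chain S d x = node_value S d j - d j * (x - S j).
  case: j {right right_lt} => [|j].
    exists (S 0%N - 1) => [|x _ xS]; first by lra.
    by rewrite chain_init//= sub0r mulNr.
  have m0 : 0 < S j.+1 - S j by rewrite subr_gt0.
  have dm : 0 < d j.+1 * (S j.+1 - S j) by exact: mulr_gt0.
  have dm1 : d j.+1 * (S j.+1 - S j) <= S j.+1 - S j by rewrite ger_pMl.
  have d_ge0 := ltW (d0 j).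
  have d_gtN1 : -1 < d j.+1 by have := d0 j.+1; lra.
  exists (S j + (d j.+1 + 14) / 16 * (S j.+1 - S j)) => [|x ax xS]; first by lra.
  rewrite (@chain_node _ S d j)//=; last by lra.
  by rewrite !piece_end//; [ring|lra|lra].
have [a aS left_eq] := left.
have xI : S j \in `]a, S j + (2 - d j) / 16 * (S j.+1 - S j)[.
  by rewrite in_itv/= aS.
apply: filterS (near_in_itvoo xI) => x; rewrite in_itv/= => /andP[ax xb].
by have [xS|Sx] := leP x (S j); [exact: left_eq|exact: right].
Qed.

Lemma chain_at_node (R : realType) (S d : nat -> R) (j : nat) :
  (forall i, S i < S i.+1) -> (forall i, 0 < d i <= 1) ->
  chain S d (S j) = node_value S d j.
Proof.
move=> Si di; rewrite (nbhs_singleton (chain_near_node j Si di)).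
by rewrite subrr mulr0 subr0.
Qed.

Lemma node_value_uniform (R : realType) (m : R) (S d : nat -> R) (j : nat) :
  0 < m -> (forall i, S i = m * i%:R) -> (forall i, d i = 1) ->
  node_value S d j = m / 2 * j%:R.
Proof.
move=> m0 hS hd; elim: j => [|j IH]; first by rewrite mulr0.
have -> : node_value S d j.+1 =
  piece (S j.+1 - S j) (d j) (d j.+1) (S j.+1 - S j) + node_value S d j by [].
have -> : S j.+1 - S j = m by rewrite !hS -natr1; ring.
by rewrite IH !hd piece_end//; [rewrite -natr1; field|lra..].
Qed.

Lemma derive1_near_affine (R : realType) (f : R -> R) (a b c : R) :
  (\forall x \near a, f x = b + c * (x - a)) -> f^`()%classic a = c.
Proof.
move=> fa; rewrite derive1E (near_eq_derive _ fa).
have -> : (fun x => b + c * (x - a)) = cst b + c \*: (id - cst a) by [].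
rewrite deriveD// derive_cst deriveZ//= deriveB// derive_id derive_cst.
by rewrite add0r subr0 /GRing.scale /= mulr1.
Qed.

(** [f] is affine around every point close to [a], so its derivative is
    constant around [a]. *)
Lemma derive2_near_affine (R : realType) (f : R -> R) (a b c : R) :
  (\forall x \near a, f x = b + c * (x - a)) -> f^`(2)%classic a = 0.
Proof.
move=> fa; rewrite derive1nS derive1n1.
apply: (@derive1_near_affine _ _ _ c).
apply: filterS (near_join fa) => x fx; rewrite mul0r addr0.
apply: (@derive1_near_affine _ _ _ (b + c * (x - a))).
by apply: filterS fx => y ->; ring.
Qed.

(** Without curvature the iteration is plain gradient descent, and the
    choice of [s'] leaves no freedom. *)
Lemma two_step_affine (R : realType) (F : R -> R) (m m' a b c : R)
    (next : option R) :
  c != 0 -> (\forall x \near a, F x = b + c * (x - a)) ->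
  two_step F m m' a next -> next = Some (a - m * c).
Proof.
move=> c0 Fa [s']; rewrite /curvature_step (derive2_near_affine Fa) lexx => ->.
rewrite (derive1_near_affine Fa) oppr_eq0 (negbTE c0) /= => ->.
by rewrite mulr0 addr0 mulrN.
Qed.

Theorem proposition3p8 (R : realType) (m m' : R) (hm : 0 < m) (hm' : 0 < m')
    (S d : nat -> R) (hS : forall j, S j = m * j%:R) (hd : forall j, d j = 1)
    (F : R -> R) (hF : F = chain S d)
    (run : nat -> option R) (hrun : two_step_run F m m' 0 run) :
  exists theta : nat -> R,
    (forall j, run j = Some (theta j)) /\
    F (theta j) @[j --> \oo] --> +oo /\
    inf [set `|F^`()%classic (theta j)| | j in [set: nat]] = 1.
Proof.
have Si i : S i < S i.+1 by rewrite !hS ltr_pM2l// ltr_nat.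
have di i : 0 < d i <= 1 by rewrite hd ltr01 lexx.
have FS j : \forall x \near S j, F x = node_value S d j + -1 * (x - S j).
  rewrite hF; apply: filterS (chain_near_node j Si di) => x ->.
  by rewrite hd mulN1r mul1r.
exists S; split; last split.
- have [run0 runS] := hrun; elim=> [|j IH]; first by rewrite run0 hS mulr0.
  have := runS j; rewrite IH => /(two_step_affine _ (FS j)) ->.
    by rewrite !hS -natr1; congr Some; ring.
  by rewrite oppr_eq0 oner_eq0.
- have -> : (fun j => F (S j)) = (fun j => m / 2 * j%:R).
    by apply/funext => j; rewrite hF chain_at_node// (node_value_uniform _ hm).
  apply/cvgryPge => A; near=> n.
  rewrite mulrC -ler_pdivrMr ?divr_gt0//.
  by near: n; exact: nbhs_infty_ger.
- have -> : [set `|F^`()%classic (S j)| | j in [set: nat]] = [set 1].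
    apply/seteqP; split => [_ [j _ <-]|_ ->] /=.
      by rewrite (derive1_near_affine (FS j)) normrN1.
    by exists 0%N => //; rewrite (derive1_near_affine (FS 0%N)) normrN1.
  exact: inf1.
Unshelve. all: by end_near. Qed.
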